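(* Let $G$ be a group. Then the following hold for all $n\ge 0$. (1) $I^n B(G)=\gamma_{n+2}(G/G'')$, where $I$ is the augmentation ideal of $\mathbb{Z}[G_{\mathrm{ab}}]$. (2) $I^n\big(B_{\mathbb{Q}}(G)\otimes\mathbb{Q}\big)=\gamma^{\mathbb{Q}}_{n+2}(G/G''_{\mathbb{Q}})\otimes\mathbb{Q}$, where $I$ is the augmentation ideal of $\mathbb{Q}[G_{\mathrm{abf}}]$. (3) For every prime $p$, $I^n B_p(G)=\gamma^{p}_{n+2}(G/G''_p)$, where $I$ is the augmentation ideal of $\mathbb{Z}_p[H_1(G;\mathbb{Z}_p)]$.
   Context: For a group $G$: $[a,b]=aba^{-1}b^{-1}$; for subgroups $H,K$, $[H,K]$ is the subgroup generated by all $[h,k]$. For a subset $S\subseteq G$, $\sqrt{S}=\{g\in G: g^m\in S\text{ for some }m>0\}$. For a subgroup $H$, $H^p$ is the subgroup generated by all $p$-th powers of elements of $H$. $\mathbb{Z}_p=\mathbb{Z}/p\mathbb{Z}$. Lower central series: $\gamma_1(G)=G$, $\gamma_{n+1}(G)=[G,\gamma_n(G)]$. Rational version: $\gamma_1^{\mathbb{Q}}(G)=G$, $\gamma^{\mathbb{Q}}_{n+1}(G)=\sqrt{[G,\gamma^{\mathbb{Q}}_n(G)]}$. Mod-$p$ version: $\gamma^p_1(G)=G$, $\gamma^p_{n+1}(G)=\langle (\gamma^p_n(G))^p,[G,\gamma^p_n(G)]\rangle$. Derived series: $G'=[G,G]$, $G''=[G',G']$. Rational version: $G'_{\mathbb{Q}}=\sqrt{[G,G]}$,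 $G''_{\mathbb{Q}}=\sqrt{[G'_{\mathbb{Q}},G'_{\mathbb{Q}}]}$. Mod-$p$ version: $G'_p=\langle G^p,[G,G]\rangle$, $G''_p=\langle (G'_p)^p,[G'_p,G'_p]\rangle$. All these are normal subgroups of $G$. $G_{\mathrm{ab}}=G/G'$; $G_{\mathrm{abf}}=G/G'_{\mathbb{Q}}=G_{\mathrm{ab}}/\mathrm{Tors}$; $G/G'_p=H_1(G;\mathbb{Z}_p)$. Alexander invariants: $B(G)=G'/G''$ as a $\mathbb{Z}[G_{\mathrm{ab}}]$-module; $B_{\mathbb{Q}}(G)=G'_{\mathbb{Q}}/G''_{\mathbb{Q}}$ as a $\mathbb{Z}[G_{\mathrm{abf}}]$-module; $B_p(G)=G'_p/G''_p$ as a $\mathbb{Z}_p[H_1(G;\mathbb{Z}_p)]$-module. In each case addition comes from multiplication in $G$ and the action is induced by conjugation, $g\cdot x=gxg^{-1}$. The equalities in the theorem are equalities of subgroups (subspaces) of $B(G)=G'/G''$, of $B_{\mathbb{Q}}(G)\otimes\mathbb{Q}=(G'_{\mathbb{Q}}/G''_{\mathbb{Q}})\otimes\mathbb{Q}$, and of $B_p(G)=G'_p/G''_p$, respectively; for $n\ge 0$ the groups $\gamma_{n+2}(G/G'')$, $\gamma^{\mathbb{Q}}_{n+2}(G/G''_{\mathbb{Q}})$, $\gamma^p_{n+2}(G/G''_p)$ are subgroups of $G'/G''$, $G'_{\mathbb{Q}}/G''_{\mathbb{Q}}$, $G'_p/G''_p$. *)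

(* Defs.v *)
From HB Require Import structures.
From mathcomp Require Import all_boot all_order all_algebra.
From mathcomp Require Import boolp classical_sets.
From mathcomp Require Import finmap monalg.

Set Implicit Arguments.
Unset Strict Implicit.
Unset Printing Implicit Defensive.

Import GRing.Theory.

Local Open Scope classical_set_scope.
Local Open Scope quotient_scope.

Section Subgroups.
Local Open Scope group_scope.
Variable G : groupType.
Implicit Types (H K S : set G) (a b g x y : G).

Definition is_subgroup H :=
  [/\ H 1, forall x y, H x -> H y -> H (x * y) & forall x, H x -> H x^-1].

Definition is_normal H :=
  is_subgroup H /\ forall g x, H x -> H (g * x * g^-1).

Definition gspan S : set G := smallest is_subgroup S.

(* MathComp's [~ a, b] is the other convention, a^-1 * b^-1 * a * b. *)
Definition gcomm a b := a * b * a^-1 * b^-1.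

Definition gcommS H K : set G :=
  gspan [set z | exists2 h, H h & exists2 k, K k & z = gcomm h k].

Definition groot S : set G := [set g | exists2 m, (0 < m)%N & S (g ^+ m)].

Definition gpowS (p : nat) H : set G :=
  gspan [set z | exists2 h, H h & z = h ^+ p].

Definition dersZ H : set G := gcommS H H.
Definition dersQ H : set G := groot (gcommS H H).
Definition dersp (p : nat) H : set G := gspan (gpowS p H `|` gcommS H H).

End Subgroups.

(* The three lower central series are indexed from 1; the value at 0 is junk
   (the whole group). *)
Definition lcsZ (G : groupType) (n : nat) : set G :=
  iter n.-1 (fun H => gcommS setT H) setT.
Definition lcsQ (G : groupType) (n : nat) : set G :=
  iter n.-1 (fun H => groot (gcommS setT H)) setT.
Definition lcsp (p : nat) (G : groupType) (n : nat) : set G :=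
  iter n.-1 (fun H => gspan (gpowS p H `|` gcommS setT H)) setT.
Arguments lcsZ G n : clear implicits.
Arguments lcsQ G n : clear implicits.
Arguments lcsp p G n : clear implicits.

Section SubgroupTheory.
Local Open Scope group_scope.
Variable G : groupType.
Implicit Types (H K S : set G) (a b g x y : G).

Lemma gspan_subgroup S : is_subgroup (gspan S).
Proof.
split=> [A [[]] // | x y Hx Hy A AS | x Hx A AS].
  by case: (AS) => -[_ AM _] _; apply: AM; [exact: Hx|exact: Hy].
by case: (AS) => -[_ _ AV] _; apply: AV; exact: Hx.
Qed.

Lemma sub_gspan S : S `<=` gspan S.
Proof. exact: sub_gen_smallest. Qed.

Lemma gspan_sub S H : is_subgroup H -> S `<=` H -> gspan S `<=` H.
Proof. exact: smallest_sub. Qed.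

Lemma conjgE' g x : g * x * g^-1 = x ^ g^-1.
Proof. by rewrite conjgE invgK mulgA. Qed.

Lemma gcommE a b : gcomm a b = [~ a^-1, b^-1].
Proof. by rewrite /gcomm commgEl conjgE !invgK !mulgA. Qed.

Lemma gcommJ a b g : gcomm a b ^ g = gcomm (a ^ g) (b ^ g).
Proof. by rewrite !gcommE conjRg !conjVg. Qed.

Lemma gspan_normal S : (forall g x, S x -> S (g * x * g^-1)) ->
  is_normal (gspan S).
Proof.
move=> SJ; split=> [|g x]; first exact: gspan_subgroup.
pose T := [set y | gspan S (g * y * g^-1)].
suff: gspan S `<=` T by apply.
have [S1 SM SV] := gspan_subgroup S.
apply: gspan_sub => [|y Sy]; last by apply: sub_gspan; exact: SJ.
split; rewrite /T /=; first by rewrite conjgE' conj1g.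
- by move=> y z Ty Tz; rewrite conjgE' conjMg -!conjgE'; apply: SM.
- by move=> y Ty; rewrite conjgE' conjVg -conjgE'; apply: SV.
Qed.

Lemma setT_normal : is_normal [set: G].
Proof. by []. Qed.

Lemma gcommS_normal H K : is_normal H -> is_normal K -> is_normal (gcommS H K).
Proof.
move=> [_ HJ] [_ KJ]; apply: gspan_normal => g _ [h Hh [k Kk ->]].
exists (g * h * g^-1); first exact: HJ.
exists (g * k * g^-1); first exact: KJ.
by rewrite !conjgE' gcommJ.
Qed.

Lemma gcommS_subr H K : is_subgroup H -> is_normal K -> gcommS H K `<=` K.
Proof.
move=> _ [[K1 KM KV] KJ]; apply: gspan_sub => // _ [h Hh [k Kk ->]].
by apply: KM; [exact: KJ|exact: KV].
Qed.

Lemma gpowS_normal p H : is_normal H -> is_normal (gpowS p H).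
Proof.
move=> [_ HJ]; apply: gspan_normal => g _ [h Hh ->].
exists (g * h * g^-1); first exact: HJ.
by rewrite !conjgE' conjXg.
Qed.

Lemma gspanU_normal H K : is_normal H -> is_normal K ->
  is_normal (gspan (H `|` K)).
Proof.
move=> [_ HJ] [_ KJ]; apply: gspan_normal => g x [Hx|Kx].
  by left; exact: HJ.
by right; exact: KJ.
Qed.

End SubgroupTheory.

Structure normal (G : groupType) := Normal {
  nset :> set G;
  nsetP : is_normal nset }.

Section Quotient.
Local Open Scope group_scope.
Variables (G : groupType) (N : normal G).
Implicit Types (x y z : G).

Let N1 : nset N 1. Proof. by case: (nsetP N) => -[]. Qed.
Let NM x y : nset N x -> nset N y -> nset N (x * y).
Proof. by case: (nsetP N) => -[_ + _ _]; apply. Qed.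
Let NV x : nset N x -> nset N x^-1. Proof. by case: (nsetP N) => -[_ _ + _]; apply. Qed.
Let NJ g x : nset N x -> nset N (g * x * g^-1). Proof. by case: (nsetP N) => _; apply. Qed.

Definition cosetrel : rel G := fun x y => `[< nset N (x * y^-1) >].

Lemma cosetrel_equiv : equiv_class_of cosetrel.
Proof.
split=> [x|x y|y x z].
- by apply/asboolP; rewrite mulgV.
- by apply/asboolP/asboolP => /NV; rewrite invgM invgK.
- move=> /asboolP xy /asboolP yz; apply/asboolP.
  by have := NM xy yz; rewrite mulgA mulgVK.
Qed.

Canonical cosetrel_canonical := EquivRelPack cosetrel_equiv.

Definition quotg := {eq_quot cosetrel}.
HB.instance Definition _ := Choice.on quotg.

Definition qproj (x : G) : quotg := \pi_(quotg) x.

Lemma qprojP x y : qproj x = qproj y <-> nset N (x * y^-1).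
Proof.
by split=> [/eqP|H]; [|apply/eqP]; rewrite piE; [move/asboolP|apply/asboolP].
Qed.

Lemma qproj_repr (u : quotg) : qproj (repr u) = u.
Proof. exact: reprK. Qed.

Definition quotg_one : quotg := qproj 1.
Definition quotg_mul (u v : quotg) : quotg := qproj (repr u * repr v).
Definition quotg_inv (u : quotg) : quotg := qproj (repr u)^-1.

Lemma quotg_mulE x y : quotg_mul (qproj x) (qproj y) = qproj (x * y).
Proof.
apply/qprojP.
have /qprojP nx := qproj_repr (qproj x); have /qprojP ny := qproj_repr (qproj y).
set x' := repr _ in nx *; set y' := repr _ in ny *.
have -> : x' * y' * (x * y)^-1 = (x' * x^-1) * (x * (y' * y^-1) * x^-1).
  by rewrite invgM !mulgA mulgVK.
by apply: NM => //; apply: NJ.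
Qed.

Lemma quotg_invE x : quotg_inv (qproj x) = qproj x^-1.
Proof.
apply/qprojP; have /qprojP nx := qproj_repr (qproj x); set x' := repr _ in nx *.
have -> : x'^-1 * x^-1^-1 = x'^-1 * (x' * x^-1)^-1 * x'^-1^-1.
  by rewrite invgM !invgK mulgA mulgVK.
by apply: NJ; apply: NV.
Qed.

Let quotg_ind (P : quotg -> Prop) : (forall x, P (qproj x)) -> forall u, P u.
Proof. by move=> Pq u; rewrite -[u]qproj_repr. Qed.

Lemma quotg_mulA : associative quotg_mul.
Proof. by do 3!elim/quotg_ind=> ?; rewrite !quotg_mulE mulgA. Qed.
Lemma quotg_mul1 : left_id quotg_one quotg_mul.
Proof. by elim/quotg_ind=> ?; rewrite quotg_mulE mul1g. Qed.
Lemma quotg_mulr1 : right_id quotg_one quotg_mul.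
Proof. by elim/quotg_ind=> ?; rewrite quotg_mulE mulg1. Qed.
Lemma quotg_mulV : left_inverse quotg_one quotg_inv quotg_mul.
Proof. by elim/quotg_ind=> ?; rewrite quotg_invE quotg_mulE mulVg. Qed.
Lemma quotg_mulrV : right_inverse quotg_one quotg_inv quotg_mul.
Proof. by elim/quotg_ind=> ?; rewrite quotg_invE quotg_mulE mulgV. Qed.

HB.instance Definition _ := isGroup.Build quotg
  quotg_mulA quotg_mul1 quotg_mulr1 quotg_mulV quotg_mulrV.

Lemma qprojM x y : qproj (x * y) = qproj x * qproj y.
Proof. by rewrite -quotg_mulE. Qed.

HB.instance Definition _ := isUMagmaMorphism.Build G quotg qproj
  (erefl, qprojM).

Lemma qproj1 : qproj 1 = 1. Proof. exact: gmulf1. Qed.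
Lemma qprojV x : qproj x^-1 = (qproj x)^-1. Proof. exact: gmulfV. Qed.
Lemma qprojX x n : qproj (x ^+ n) = qproj x ^+ n. Proof. exact: gmulfXn. Qed.

Lemma qproj_eq1 x : qproj x = 1 <-> nset N x.
Proof. by rewrite -qproj1 qprojP invg1 mulg1. Qed.

End Quotient.

Section NormalSubgroups.
Local Open Scope group_scope.
Variable G : groupType.
Implicit Types (H K : set G).

Lemma gpow_closed H x n : is_subgroup H -> H x -> H (x ^+ n).
Proof.
by move=> [H1 HM _] Hx; elim: n => [|n IH]; rewrite ?expg0 // expgS; apply: HM.
Qed.

Lemma dersZ_normal H : is_normal H -> is_normal (dersZ H).
Proof. by move=> nH; apply: gcommS_normal. Qed.

Lemma dersZ_sub H : is_normal H -> dersZ H `<=` H.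
Proof. by move=> nH; apply: gcommS_subr => //; case: nH. Qed.

Lemma dersp_normal p H : is_normal H -> is_normal (dersp p H).
Proof.
by move=> nH; apply: gspanU_normal; [exact: gpowS_normal|exact: gcommS_normal].
Qed.

Lemma dersp_sub p H : is_normal H -> dersp p H `<=` H.
Proof.
move=> nH; have [sH _] := nH; apply: gspan_sub => // x [|/(dersZ_sub nH)//].
by apply: gspan_sub => // _ [h Hh ->]; exact: gpow_closed.
Qed.

Lemma groot_idem H : groot (groot H) `<=` groot H.
Proof.
move=> x [m m0 [k k0 Hx]]; exists (m * k)%N; first by rewrite muln_gt0 m0.
by rewrite expgnA.
Qed.

Lemma grootS H K : H `<=` K -> groot H `<=` groot K.
Proof. by move=> HK x [m m0 /HK Kx]; exists m. Qed.

Lemma dersQ_sub H : is_normal H -> groot H `<=` H -> dersQ H `<=` H.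
Proof. by move=> nH rH x /(grootS (dersZ_sub nH))/rH. Qed.

Lemma dersQ_isolated H : groot (dersQ H) `<=` dersQ H.
Proof. exact: groot_idem. Qed.

Lemma qproj_commute H (nH : is_normal H) x y : H x -> H y ->
  commute (qproj (Normal (dersZ_normal nH)) x)
          (qproj (Normal (dersZ_normal nH)) y).
Proof.
move=> Hx Hy; rewrite /commute -!qprojM; apply/qprojP.
rewrite invgM mulgA; apply: sub_gspan.
by exists x => //; exists y.
Qed.

Lemma dersQ_normal H : is_normal H -> groot H `<=` H -> is_normal (dersQ H).
Proof.
move=> nH rH; have QH := dersQ_sub nH rH.
have [[C1 CM CV] CJ] := dersZ_normal nH.
split; first split.
- by exists 1%N; rewrite ?expg1.
- move=> x y Qx Qy; have [Hx Hy] := (QH _ Qx, QH _ Qy).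
  have xy := qproj_commute nH Hx Hy; case: Qx Qy => [m m0 Cx] [n n0 Cy].
  exists (m * n)%N; first by rewrite muln_gt0 m0.
  apply/(qproj_eq1 (Normal (dersZ_normal nH))).
  have /= Ex := (qproj_eq1 (Normal (dersZ_normal nH)) _).2 Cx.
  have /= Ey := (qproj_eq1 (Normal (dersZ_normal nH)) _).2 Cy.
  rewrite qprojX qprojM expgMn // expgnA -qprojX Ex expg1n mul1g.
  by rewrite mulnC expgnA -qprojX Ey expg1n.
- by move=> x [m m0 Cx]; exists m => //; rewrite expVgn; apply: CV.
- by move=> g x [m m0 Cx]; exists m => //; rewrite conjgE' -conjXg -conjgE'; apply: CJ.
Qed.

End NormalSubgroups.

(* A pair of normal subgroups bot <= top with top / bot abelian. *)
Structure absection (G : groupType) := AbSection {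
  sec_top : normal G;
  sec_bot : normal G;
  sec_le : nset sec_bot `<=` nset sec_top;
  sec_comm : gcommS (nset sec_top) (nset sec_top) `<=` nset sec_bot }.

Local Open Scope ring_scope.

Section SectionModule.
Variables (G : groupType) (s : absection G).
Local Notation N1 := (sec_top s).
Local Notation N2 := (sec_bot s).

Definition in_secmod : pred (quotg N2) :=
  fun u => `[< (qproj N2 @` nset N1) u >].

Record secmod := SecMod { secval : quotg N2; secvalP : in_secmod secval }.

HB.instance Definition _ := [isSub of secmod for secval].
HB.instance Definition _ := [Choice of secmod by <:].

Let in_secmodP u : in_secmod u -> exists2 x, nset N1 x & qproj N2 x = u.
Proof. by move/asboolP. Qed.

Lemma in_secmod1 : in_secmod 1%g.
Proof. by apply/asboolP; exists 1%g => //; case: (nsetP N1) => -[]. Qed.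

Lemma in_secmodM u v : in_secmod u -> in_secmod v -> in_secmod (u * v)%g.
Proof.
move=> /in_secmodP[x Nx <-] /in_secmodP[y Ny <-]; apply/asboolP.
exists (x * y)%g; last exact: qprojM.
by case: (nsetP N1) => -[_ + _ _]; apply.
Qed.

Lemma in_secmodV u : in_secmod u -> in_secmod u^-1%g.
Proof.
move=> /in_secmodP[x Nx <-]; apply/asboolP.
exists x^-1%g; last exact: qprojV.
by case: (nsetP N1) => -[_ _ + _]; apply.
Qed.

Lemma in_secmodJ (g : G) u :
  in_secmod u -> in_secmod (qproj N2 g * u * (qproj N2 g)^-1)%g.
Proof.
move=> /in_secmodP[x Nx <-]; apply/asboolP.
exists (g * x * g^-1)%g; last by rewrite !qprojM qprojV.
by case: (nsetP N1) => _; apply.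
Qed.

Definition sec0 : secmod := SecMod in_secmod1.
Definition secopp (x : secmod) : secmod := SecMod (in_secmodV (secvalP x)).
Definition secadd (x y : secmod) : secmod :=
  SecMod (in_secmodM (secvalP x) (secvalP y)).

Lemma secaddA : associative secadd.
Proof. by move=> x y z; apply: val_inj; rewrite /= mulgA. Qed.
Lemma secadd0 : left_id sec0 secadd.
Proof. by move=> x; apply: val_inj; rewrite /= mul1g. Qed.
Lemma secaddN : left_inverse sec0 secopp secadd.
Proof. by move=> x; apply: val_inj; rewrite /= mulVg. Qed.
Lemma secaddC : commutative secadd.
Proof.
move=> [u /= up] [v /= vp]; apply: val_inj => /=.
have [x Nx <-] := in_secmodP up; have [y Ny <-] := in_secmodP vp.
rewrite -!qprojM; apply/qprojP; apply: sec_comm; apply: sub_gspan.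
by exists x => //; exists y; rewrite // /gcomm invgM !mulgA.
Qed.

HB.instance Definition _ :=
  GRing.isZmodule.Build secmod secaddA secaddC secadd0 secaddN.

Lemma secval0 : secval 0 = 1%g. Proof. by []. Qed.
Lemma secvalD x y : secval (x + y) = (secval x * secval y)%g. Proof. by []. Qed.
Lemma secvalN x : secval (- x) = (secval x)^-1%g. Proof. by []. Qed.
Lemma secvalMn x n : secval (x *+ n) = (secval x ^+ n)%g.
Proof. by elim: n => [|n IH]; rewrite ?mulr0n // mulrS secvalD IH expgS. Qed.

(* Conjugation; independent of the representative by secactE. *)
Definition secact (g : quotg N1) (x : secmod) : secmod :=
  SecMod (in_secmodJ (repr g) (secvalP x)).

Lemma secactE (g : G) x :
  secval (secact (qproj N1 g) x)
    = (qproj N2 g * secval x * (qproj N2 g)^-1)%g.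
Proof.
case: x => u up /=; have [x Nx <-] := in_secmodP up.
have /qprojP := qproj_repr (qproj N1 g); set h := repr _ => N1hg.
rewrite -!qprojV -!qprojM; apply/qprojP.
have [_ NJ] := nsetP N2; have [[_ _ NV] N1J] := nsetP N1.
have : nset N2 (gcomm (h * g^-1) (g * x * g^-1)).
  apply: sec_comm; apply: sub_gspan; exists (h * g^-1)%g => //; exists (g * x * g^-1)%g => //; exact: N1J.
by rewrite /gcomm !invgM !invgK !mulgA !mulgVK.
Qed.

End SectionModule.

Structure gaction (Gam : groupType) (M : zmodType) := GAction {
  gact :> Gam -> M -> M;
  gact1 : forall v, gact 1%g v = v;
  gactM : forall g h v, gact (g * h)%g v = gact g (gact h v);
  gactD : forall g u v, gact g (u + v) = gact g u + gact g v }.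

Section SectionAction.
Variables (G : groupType) (s : absection G).

Let quot_ind (N : normal G) (P : quotg N -> Prop) :
  (forall x, P (qproj N x)) -> forall u, P u.
Proof. by move=> Pq u; rewrite -[u]qproj_repr. Qed.

Let sec_inj (u v : secmod s) : secval u = secval v -> u = v.
Proof. exact: val_inj. Qed.

Lemma secact1 (v : secmod s) : secact 1%g v = v.
Proof. by apply: sec_inj; rewrite -qproj1 secactE qproj1 mul1g invg1 mulg1. Qed.

Lemma secactM g h (v : secmod s) : secact (g * h)%g v = secact g (secact h v).
Proof.
elim/quot_ind: g => g; elim/quot_ind: h => h; apply: sec_inj.
by rewrite -qprojM !secactE qprojM invgM !mulgA.
Qed.

Lemma secactD g (u v : secmod s) : secact g (u + v) = secact g u + secact g v.
Proof.
elim/quot_ind: g => g; apply: sec_inj.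
by rewrite !secvalD !secactE secvalD !mulgA mulgVK.
Qed.

Definition sec_action : gaction (quotg (sec_top s)) (secmod s) :=
  GAction secact1 secactM secactD.

End SectionAction.
Section LinearExtension.
Variables (K : choiceType) (R : nzRingType) (V : lmodType R) (b : K -> V).
Implicit Types f g : {malg R[K]}.

Definition linext f : V := \sum_(k <- msupp f) f@_k *: b k.

Lemma linextEw f (d : {fset K}) : (msupp f `<=` d)%fset ->
  linext f = \sum_(k <- d) f@_k *: b k.
Proof.
move=> fd; rewrite /linext (big_fset_incl _ fd) // => k _ /mcoeff_outdom ->.
by rewrite scale0r.
Qed.

Lemma linext_is_linear : linear linext.
Proof.
move=> c f g; pose d := (msupp f `|` msupp g `|` msupp (c *: f + g))%fset.
have sub h : h \in [:: f; g; c *: f + g] -> (msupp h `<=` d)%fset.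
  rewrite !inE => /or3P[] /eqP ->; apply/fsubsetP => k kh;
  by rewrite !inE kh ?orbT.
rewrite !(linextEw (sub _ _)) ?inE ?eqxx ?orbT //.
rewrite scaler_sumr -big_split; apply: eq_bigr => k _ /=.
by rewrite mcoeffD mcoeffZ scalerDl scalerA.
Qed.

HB.instance Definition _ := GRing.isLinear.Build R {malg R[K]} V *:%R linext
  linext_is_linear.

Lemma linextU c k : linext << c *g k >> = c *: b k.
Proof.
rewrite (linextEw (d := [fset k]%fset)) ?msuppU_le //.
by rewrite big_seq_fset1 mcoeffUU.
Qed.

End LinearExtension.

Lemma malgUZ (K : choiceType) (R : nzRingType) (c : R) (k : K) :
  << c *g k >> = c *: << 1 *g k >> :> {malg R[K]}.
Proof. by apply/malgP=> l; rewrite mcoeffZ !mcoeffU mulrnAr mulr1. Qed.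

Lemma malg_linear_eq (K : choiceType) (R : nzRingType) (V : lmodType R)
    (u v : {linear {malg R[K]} -> V}) :
  (forall k, u << 1 *g k >> = v << 1 *g k >>) -> u =1 v.
Proof.
move=> uv f; rewrite (monalgE f) !linear_sum; apply: eq_bigr => k _.
by rewrite malgUZ !linearZ uv.
Qed.

Definition groupRing (R : comNzRingType) (Gam : groupType) := {malg R[Gam]}.

Section GroupRing.
Variables (R : comNzRingType) (Gam : groupType).
Implicit Types f g h : groupRing R Gam.

HB.instance Definition _ := GRing.Lmodule.on (groupRing R Gam).

Definition grone : groupRing R Gam := << 1 *g 1%g >>.
Definition grmul f g : groupRing R Gam :=
  \sum_(x <- msupp f) \sum_(y <- msupp g) << f@_x * g@_y *g (x * y)%g >>.

Let mulb (g : {malg R[Gam]}) (x : Gam) : {malg R[Gam]} :=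
  linext (fun y => << 1 *g (x * y)%g >>) g.

Lemma grmulE f g : grmul f g = linext (mulb g) f.
Proof.
apply: eq_bigr => x _; rewrite /mulb /linext scaler_sumr; apply: eq_bigr => y _.
by rewrite scalerA -malgUZ.
Qed.

Lemma grmul_linl g : linear (grmul^~ g).
Proof. by move=> c f1 f2; rewrite !grmulE linearP. Qed.

Lemma grmul_linr f : linear (grmul f).
Proof.
move=> c g1 g2; rewrite !grmulE /linext scaler_sumr -big_split.
apply: eq_bigr => x _; rewrite /mulb linearP scalerDr /= !scalerA.
by rewrite [f@_x * c]mulrC.
Qed.

Lemma grmul0 f : grmul 0 f = 0 /\ grmul f 0 = 0.
Proof.
split; first by rewrite grmulE linear0.
by have := grmul_linr f (-1) 0 0; rewrite !scaleN1r !addNr.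
Qed.

Lemma grmulU a b x y :
  grmul << a *g x >> << b *g y >> = << a * b *g (x * y)%g >>.
Proof. by rewrite grmulE linextU /mulb linextU scalerA -malgUZ. Qed.

Lemma malg_ind (P : {malg R[Gam]} -> Prop) :
  (forall c f g, P f -> P g -> P (c *: f + g)) -> P 0 ->
  (forall k, P << 1 *g k >>) -> forall f, P f.
Proof.
move=> PD P0 PU f; rewrite (monalgE f); elim/big_ind: _ => //.
  by move=> u v Pu Pv; rewrite -[u]scale1r; apply: PD.
by move=> k _; rewrite malgUZ -[_ *: _]addr0; apply: PD.
Qed.

Lemma grmulA : associative grmul.
Proof.
move=> f g h; elim/malg_ind: f => [c f1 f2 E1 E2||x].
- by rewrite 3!grmul_linl E1 E2.
- by rewrite !(grmul0 _).1.
elim/malg_ind: g => [c f1 f2 E1 E2||y].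
- by rewrite grmul_linl !grmul_linr grmul_linl E1 E2.
- by rewrite !((grmul0 _).1, (grmul0 _).2).
elim/malg_ind: h => [c f1 f2 E1 E2||z].
- by rewrite !grmul_linr E1 E2.
- by rewrite !(grmul0 _).2.
by rewrite !grmulU mulgA mulrA.
Qed.

Lemma grmul1 : left_id grone grmul.
Proof.
elim/malg_ind => [c f1 f2 E1 E2||y].
- by rewrite grmul_linr E1 E2.
- by rewrite (grmul0 _).2.
by rewrite grmulU mul1g mul1r.
Qed.

Lemma grmulr1 : right_id grone grmul.
Proof.
elim/malg_ind => [c f1 f2 E1 E2||y].
- by rewrite grmul_linl E1 E2.
- by rewrite (grmul0 _).1.
by rewrite grmulU mulg1 mulr1.
Qed.

Lemma grmulDl : left_distributive grmul +%R.
Proof. by move=> f g h; rewrite -[f]scale1r grmul_linl !scale1r. Qed.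
Lemma grmulDr : right_distributive grmul +%R.
Proof. by move=> f g h; rewrite -[g]scale1r grmul_linr !scale1r. Qed.
Lemma grone_neq0 : grone != 0.
Proof. by rewrite monalgU_eq0 oner_neq0. Qed.

HB.instance Definition _ := GRing.Zmodule_isNzRing.Build (groupRing R Gam)
  grmulA grmul1 grmulr1 grmulDl grmulDr grone_neq0.

Definition augmentation f : R := \sum_(x <- msupp f) f@_x.
Definition augIdeal : set (groupRing R Gam) := [set f | augmentation f = 0].

End GroupRing.

Arguments augIdeal R Gam : clear implicits.

Structure grep (R : comNzRingType) (Gam : groupType) (V : lmodType R) := GRep {
  grep_act :> gaction Gam V;
  grepZ : forall g c v, grep_act g (c *: v) = c *: grep_act g v }.

(* The R[Gam]-module afforded by a representation: V with a new scalar ring. *)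
Definition grmod (R : comNzRingType) (Gam : groupType) (V : lmodType R)
  (rho : grep Gam V) : Type := V.

Section GroupRingModule.
Variables (R : comNzRingType) (Gam : groupType) (V : lmodType R).
Variable rho : grep Gam V.
Implicit Types (f g : groupRing R Gam) (v : V).

HB.instance Definition _ := GRing.Zmodule.on (grmod rho).

Definition grscale f (v : grmod rho) : grmod rho :=
  \sum_(x <- msupp f) f@_x *: (rho x v : V).

Lemma grscaleE f v : grscale f v = linext (fun x => rho x v) f.
Proof. by []. Qed.

Lemma gact_lin x c u v : rho x (c *: u + v) = c *: rho x u + rho x v.
Proof. by rewrite gactD grepZ. Qed.

Lemma grscale_linl c f g v :
  grscale (c *: (f : {malg R[Gam]}) + g) v =
    c *: (grscale f v : V) + grscale g v.
Proof. by rewrite !grscaleE linearP. Qed.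

Lemma grscaleDr : right_distributive grscale +%R.
Proof.
move=> f u v; rewrite /grscale -big_split; apply: eq_bigr => x _ /=.
by rewrite gactD scalerDr.
Qed.

Lemma grscaleDl v : {morph grscale^~ v : f g / f + g}.
Proof. by move=> f g /=; rewrite !grscaleE linearD. Qed.

Lemma grscaleU c x v : grscale << c *g x >> v = c *: (rho x v : V).
Proof. by rewrite grscaleE linextU. Qed.

Lemma grscale1 : left_id 1 grscale.
Proof. by move=> v; rewrite grscaleU gact1 scale1r. Qed.

Lemma grscaleZr f c v : grscale f (c *: v) = c *: (grscale f v : V).
Proof.
rewrite /grscale scaler_sumr; apply: eq_bigr => x _.
by rewrite grepZ !scalerA mulrC.
Qed.

Lemma grscaleA f g v : grscale f (grscale g v) = grscale (f * g) v.
Proof.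
elim/malg_ind: f => [c f1 f2 E1 E2||x].
- by rewrite grscale_linl E1 E2 -grscale_linl; congr grscale; rewrite -grmul_linl.
- by rewrite !(mul0r, grscaleE, linear0).
elim/malg_ind: g => [c f1 f2 E1 E2||y].
- rewrite grscale_linl grscaleDr grscaleZr E1 E2 -grscale_linl.
  by congr grscale; rewrite -grmul_linr.
- have -> : grscale 0 v = 0 by rewrite grscaleE linear0.
  have -> : grscale << 1 *g x >> 0 = 0.
    by apply: (addrI (grscale << 1 *g x >> 0)); rewrite -grscaleDr !addr0.
  by rewrite mulr0 grscaleE linear0.
have -> : (<< 1 *g x >> : groupRing R Gam) * << 1 *g y >> = << 1 *g (x * y)%g >>.
  by rewrite -[1 in RHS]mulr1 -grmulU.
by rewrite !grscaleU gactM !scale1r.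
Qed.

HB.instance Definition _ := GRing.Zmodule_isLmodule.Build (groupRing R Gam)
  (grmod rho) grscaleA grscale1 grscaleDr grscaleDl.

End GroupRingModule.
Section AdditiveSpan.
Variable V : zmodType.
Implicit Types S W : set V.

Definition is_zsubgroup W :=
  [/\ W 0, forall x y, W x -> W y -> W (x + y) & forall x, W x -> W (- x)].

Definition zspan S : set V := smallest is_zsubgroup S.

Lemma zspan_zsubgroup S : is_zsubgroup (zspan S).
Proof.
split=> [A [[]] // | x y Hx Hy A AS | x Hx A AS].
  by case: (AS) => -[_ AD _] _; apply: AD; [exact: Hx|exact: Hy].
by case: (AS) => -[_ _ AN] _; apply: AN; exact: Hx.
Qed.

Lemma sub_zspan S : S `<=` zspan S.
Proof. exact: sub_gen_smallest. Qed.

Lemma zspan_sub S W : is_zsubgroup W -> S `<=` W -> zspan S `<=` W.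
Proof. exact: smallest_sub. Qed.

End AdditiveSpan.

Section Ideals.
Variable A : nzRingType.

Definition idealM (I J : set A) : set A :=
  zspan [set c | exists2 a, I a & exists2 b, J b & c = a * b].
Definition idealX (I : set A) (n : nat) : set A := iter n (idealM I) setT.

Definition idealS (V : lmodType A) (I : set A) (W : set V) : set V :=
  zspan [set v | exists2 a, I a & exists2 w, W w & v = a *: w].

End Ideals.

Section Tensor.

Section TensorGroup.
Variables M N : zmodType.
Local Notation F := {malg int[(M * N)%type]}.

Definition tensor_relator : set F := [set r |
  (exists x x' y,
     r = << 1 *g (x + x', y) >> - << 1 *g (x, y) >> - << 1 *g (x', y) >>) \/
  (exists x y y',
     r = << 1 *g (x, y + y') >> - << 1 *g (x, y) >> - << 1 *g (x, y') >>)].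

Definition tensor_null : {pred F} := fun r => `[< zspan tensor_relator r >].

Lemma tensor_null_closed : zmod_closed tensor_null.
Proof.
have [S0 SD SN] := zspan_zsubgroup tensor_relator.
split; first exact/asboolP.
by move=> u v /asboolP Su /asboolP Sv; apply/asboolP; apply: SD => //; exact: SN.
Qed.

HB.instance Definition _ := GRing.isZmodClosed.Build F tensor_null
  tensor_null_closed.

(* M (x)_Z N: the free abelian group on M * N modulo the bilinearity relations.
   When N is an R-module, so is the tensor product, through N. *)
Definition tensor := Quotient.quot tensor_null.
HB.instance Definition _ := GRing.Zmodule.on tensor.

Definition tens (x : M) (y : N) : tensor := \pi_tensor << 1 *g (x, y) >>.

Let piB : {morph (\pi_tensor : F -> tensor) : u v / u - v}.
Proof. exact: raddfB. Qed.

Lemma tensDl x x' y : tens (x + x') y = tens x y + tens x' y.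
Proof.
apply/eqP; rewrite -subr_eq0 opprD addrA -!piB -[0](raddf0 \pi_tensor).
rewrite -Quotient.idealrBE subr0; apply/asboolP; apply: sub_zspan; left.
by exists x, x', y.
Qed.

Lemma tensDr x y y' : tens x (y + y') = tens x y + tens x y'.
Proof.
apply/eqP; rewrite -subr_eq0 opprD addrA -!piB -[0](raddf0 \pi_tensor).
rewrite -Quotient.idealrBE subr0; apply/asboolP; apply: sub_zspan; right.
by exists x, y, y'.
Qed.

Lemma tensor_ind (P : tensor -> Prop) :
  P 0 -> (forall u v, P u -> P v -> P (u + v)) -> (forall u, P u -> P (- u)) ->
  (forall x y, P (tens x y)) -> forall t, P t.
Proof.
move=> P0 PD PN PT t; rewrite -[t]reprK (monalgE (repr t)) raddf_sum.
elim/big_ind: _ => // -[x y] _.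
have -> (c : int) : << c *g (x, y) >> = << 1 *g (x, y) >> *~ c :> F.
  by rewrite -scaler_int malgUZ intz.
rewrite raddfMz; move: (_@__) => c.
have Pn n : P (tens x y *+ n).
  by elim: n => [|n IH]; rewrite ?mulr0n // mulrS; apply: PD.
case: c => n; first exact: Pn.
by rewrite NegzE mulrNz; apply: PN; exact: Pn.
Qed.

Section Lift.
Variables (P : zmodType) (b : M -> N -> P).
Hypothesis bDl : forall x x' y, b (x + x') y = b x y + b x' y.
Hypothesis bDr : forall x y y', b x (y + y') = b x y + b x y'.

Let lift_free (r : F) : P :=
  linext (fun k => b k.1 k.2 : zmodule P) r.

Let lift_freeB : {morph lift_free : u v / u - v}.
Proof. by move=> u v; rewrite /lift_free linearB. Qed.

Let lift_free0 : lift_free 0 = 0.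
Proof. by rewrite /lift_free linear0. Qed.

Let lift_freeU x y : lift_free << 1 *g (x, y) >> = b x y.
Proof. by rewrite /lift_free linextU scale1r. Qed.

Definition tensor_lift (t : tensor) : P := lift_free (repr t).

Lemma tensor_lift_pi r : tensor_lift (\pi_tensor r) = lift_free r.
Proof.
have : repr (\pi_tensor r) == r %[mod tensor] by rewrite reprK.
rewrite -Quotient.idealrBE => /asboolP.
rewrite /tensor_lift; set r' := repr _ => rr.
apply/eqP; rewrite -subr_eq0 -lift_freeB; apply/eqP.
move: {r r'} (r' - r) rr; apply: zspan_sub.
- have liftN u : lift_free u = 0 -> lift_free (- u) = 0.
    by rewrite -[- u]sub0r lift_freeB lift_free0 => ->; rewrite subr0.
  split=> //= u v u0 /liftN v0.
  by rewrite -[v]opprK lift_freeB u0 v0 subr0.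
- move=> r [[x [x' [y ->]]]|[x [y [y' ->]]]] /=; rewrite !lift_freeB !lift_freeU.
  + by rewrite bDl addrAC addrK subrr.
  + by rewrite bDr addrAC addrK subrr.
Qed.

Lemma tensor_lift_tens x y : tensor_lift (tens x y) = b x y.
Proof. by rewrite tensor_lift_pi lift_freeU. Qed.

Lemma tensor_liftB : {morph tensor_lift : u v / u - v}.
Proof.
move=> u v; rewrite -[u]reprK -[v]reprK -raddfB !tensor_lift_pi.
exact: lift_freeB.
Qed.

End Lift.

Lemma tensor_eq (P : zmodType) (u v : tensor -> P) :
  {morph u : s t / s - t} -> {morph v : s t / s - t} ->
  (forall x y, u (tens x y) = v (tens x y)) -> u =1 v.
Proof.
have z (f : tensor -> P) : {morph f : s t / s - t} -> f 0 = 0.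
  by move=> fB; have := fB 0 0; rewrite !subrr.
have fN (f : tensor -> P) : {morph f : s t / s - t} -> {morph f : s / - s}.
  by move=> fB s; rewrite -[- s]sub0r fB z // sub0r.
have fD (f : tensor -> P) : {morph f : s t / s - t} -> {morph f : s t / s + t}.
  by move=> fB s t; rewrite -{1}[t]opprK fB fN // opprK.
move=> uB vB uv; elim/tensor_ind => [|s t E1 E2|s E|x y //].
- by rewrite !z.
- by rewrite (fD u) // (fD v) // E1 E2.
- by rewrite (fN u) // (fN v) // E.
Qed.

End TensorGroup.

(* The image of S (x) N in M (x) N, for S a subgroup of M. *)
Definition tens_span (M N : zmodType) (S : set M) : set (tensor M N) :=
  zspan [set t | exists2 x, S x & exists y, t = tens x y].

Section TensorModule.
Variables (R : nzRingType) (M : zmodType) (N : lmodType R).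
Local Notation T := (tensor M N).

Let bDl (c : R) (x x' : M) (y : N) :
  tens (x + x') (c *: y) = tens x (c *: y) + tens x' (c *: y).
Proof. exact: tensDl. Qed.

Let bDr (c : R) (x : M) (y y' : N) :
  tens x (c *: (y + y')) = tens x (c *: y) + tens x (c *: y').
Proof. by rewrite scalerDr tensDr. Qed.

Definition tensor_scale (c : R) : T -> T :=
  tensor_lift (fun x y => tens x (c *: y)).

Let scaleB c : {morph tensor_scale c : s t / s - t}.
Proof. exact: tensor_liftB. Qed.

Lemma tensor_scaleE c x y : tensor_scale c (tens x y) = tens x (c *: y).
Proof. by apply: tensor_lift_tens => *; [exact: bDl|exact: bDr]. Qed.

Lemma tensor_scaleA a b t :
  tensor_scale a (tensor_scale b t) = tensor_scale (a * b) t.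
Proof.
refine (@tensor_eq M N T (fun t => tensor_scale a (tensor_scale b t))
          (tensor_scale (a * b)) _ (scaleB _) _ t).
- by move=> s1 s2; rewrite !scaleB.
- by move=> x y; rewrite !tensor_scaleE scalerA.
Qed.

Lemma tensor_scale1 : left_id 1 tensor_scale.
Proof.
move=> t; refine (@tensor_eq M N T (tensor_scale 1) id (scaleB _) _ _ t) => //.
by move=> x y; rewrite tensor_scaleE scale1r.
Qed.

Lemma tensor_scaleDr : right_distributive tensor_scale +%R.
Proof.
move=> c s t; rewrite -{1}[t]opprK scaleB -[- t]sub0r scaleB opprB.
have -> : tensor_scale c 0 = 0 by have := scaleB c 0 0; rewrite !subrr.
by rewrite subr0.
Qed.

Lemma tensor_scaleDl t : {morph tensor_scale^~ t : a b / a + b}.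
Proof.
move=> a b.
refine (@tensor_eq M N T (tensor_scale (a + b))
          (fun t => tensor_scale a t + tensor_scale b t) (scaleB _) _ _ t).
- by move=> s1 s2; rewrite !scaleB opprD addrACA.
- by move=> x y; rewrite !tensor_scaleE scalerDl tensDr.
Qed.

HB.instance Definition _ := GRing.Zmodule_isLmodule.Build R (tensor M N)
  tensor_scaleA tensor_scale1 tensor_scaleDr tensor_scaleDl.

Lemma scaler_tens c x y : c *: tens x y = tens x (c *: y) :> T.
Proof. exact: tensor_scaleE. Qed.

End TensorModule.

Section TensorAction.
Variables (Gam : groupType) (R : comNzRingType) (M : zmodType) (N : lmodType R).
Variable rho : gaction Gam M.
Local Notation T := (tensor M N).

Definition tensor_act (g : Gam) : T -> T :=
  tensor_lift (fun x y => tens (rho g x) y).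

Let bDl g x x' (y : N) :
  tens (rho g (x + x')) y = tens (rho g x) y + tens (rho g x') y.
Proof. by rewrite gactD tensDl. Qed.

Let bDr g x (y y' : N) :
  tens (rho g x) (y + y') = tens (rho g x) y + tens (rho g x) y'.
Proof. exact: tensDr. Qed.

Let actB g : {morph tensor_act g : s t / s - t}.
Proof. exact: tensor_liftB. Qed.

Lemma tensor_actE g x y : tensor_act g (tens x y) = tens (rho g x) y.
Proof. by apply: tensor_lift_tens => *; [exact: bDl|exact: bDr]. Qed.

Lemma tensor_act1 t : tensor_act 1%g t = t.
Proof.
refine (@tensor_eq M N T (tensor_act 1%g) id (actB _) _ _ t) => //.
by move=> x y; rewrite tensor_actE gact1.
Qed.

Lemma tensor_actM g h t : tensor_act (g * h)%g t = tensor_act g (tensor_act h t).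
Proof.
refine (@tensor_eq M N T (tensor_act (g * h)%g)
          (fun t => tensor_act g (tensor_act h t)) (actB _) _ _ t).
- by move=> s1 s2; rewrite !actB.
- by move=> x y; rewrite !tensor_actE gactM.
Qed.

Lemma tensor_actD g s t : tensor_act g (s + t) = tensor_act g s + tensor_act g t.
Proof.
rewrite -{1}[t]opprK actB -[- t]sub0r actB opprB.
have -> : tensor_act g 0 = 0 by have := actB g 0 0; rewrite !subrr.
by rewrite subr0.
Qed.

Lemma tensor_actZ g c t : tensor_act g (c *: t) = c *: tensor_act g t.
Proof.
refine (@tensor_eq M N T (fun t => tensor_act g (c *: t))
          (fun t => c *: tensor_act g t) _ _ _ t).
- by move=> s1 s2; rewrite scalerBr actB.
- by move=> s1 s2; rewrite actB scalerBr.
- by move=> x y; rewrite scaler_tens !tensor_actE scaler_tens.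
Qed.

Definition tensor_rep : grep Gam T :=
  @GRep R Gam T (GAction tensor_act1 tensor_actM tensor_actD) tensor_actZ.

End TensorAction.

End Tensor.

Arguments tens_span {M} N S.

Section IntegralRep.
Variables (Gam : groupType) (M : zmodType) (rho : gaction Gam M).

Let rho_zmod : gaction Gam (zmodule M) :=
  @GAction Gam (zmodule M) rho (gact1 rho) (gactM rho) (gactD rho).

Let gact0 g : rho g 0 = 0.
Proof. by apply: (addrI (rho g 0)); rewrite -gactD !addr0. Qed.

Let gactN g v : rho g (- v) = - rho g v.
Proof. by apply/eqP; rewrite -addr_eq0 -gactD addNr gact0. Qed.

Lemma gactMn g v n : rho g (v *+ n) = rho g v *+ n.
Proof. by elim: n => [|n IH]; rewrite ?mulr0n ?gact0 // !mulrS gactD IH. Qed.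

Lemma zmodule_actZ g (c : int) (v : zmodule M) :
  rho_zmod g (c *: v) = c *: (rho_zmod g v : zmodule M).
Proof.
rewrite !scalezrE /=; case: c => n; first by rewrite -!pmulrn gactMn.
by rewrite NegzE !mulrNz gactN -!pmulrn gactMn.
Qed.

Definition zmodule_rep : grep Gam (zmodule M) := GRep zmodule_actZ.

End IntegralRep.

(* An abelian group of exponent dividing p, as a vector space over 'F_p. *)
Definition pmodule (p : nat) (M : zmodType) (hp : prime p)
  (hM : forall x : M, x *+ p = 0) : Type := M.

Section PModule.
Variables (p : nat) (M : zmodType) (hp : prime p).
Hypothesis hM : forall x : M, x *+ p = 0.
Local Notation V := (pmodule hp hM).

HB.instance Definition _ := GRing.Zmodule.on V.

Definition pscale (a : 'F_p) (x : V) : V := x *+ a.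

Let mulrn_mod (x : V) n : x *+ (n %% (Zp_trunc (pdiv p)).+2)%N = x *+ n.
Proof.
rewrite Fp_cast // {2}(divn_eq n p) mulrnDr mulnC mulrnA.
by have -> : x *+ p = 0 := hM x; rewrite mul0rn add0r.
Qed.

Lemma pscaleA a b x : pscale a (pscale b x) = pscale (a * b) x.
Proof. by rewrite /pscale /= mulrn_mod -mulrnA mulnC. Qed.
Lemma pscale1 : left_id 1 pscale.
Proof. by move=> x; rewrite /pscale /= modn_small. Qed.
Lemma pscaleDr : right_distributive pscale +%R.
Proof. by move=> a x y; rewrite /pscale mulrnDl. Qed.
Lemma pscaleDl x : {morph pscale^~ x : a b / a + b}.
Proof. by move=> a b; rewrite /pscale /= mulrn_mod mulrnDr. Qed.

HB.instance Definition _ := GRing.Zmodule_isLmodule.Build 'F_p V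
  pscaleA pscale1 pscaleDr pscaleDl.

Variables (Gam : groupType) (rho : gaction Gam M).

Let rho_pmod : gaction Gam V :=
  @GAction Gam V rho (gact1 rho) (gactM rho) (gactD rho).

Lemma pmodule_actZ g (c : 'F_p) (v : V) :
  rho_pmod g (c *: v) = c *: (rho_pmod g v : V).
Proof. exact: gactMn. Qed.

Definition pmodule_rep : grep Gam V := GRep pmodule_actZ.

End PModule.

Section AlexanderInvariants.
Variable G : groupType.

Definition wholeN : normal G := Normal (@setT_normal G).

Definition derZ : normal G := Normal (dersZ_normal (nsetP wholeN)).
Definition der2Z : normal G := Normal (dersZ_normal (nsetP derZ)).

Lemma groot_wholeN : groot (nset wholeN) `<=` nset wholeN. Proof. by []. Qed.

Definition derQ : normal G := Normal (dersQ_normal (nsetP wholeN) groot_wholeN).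
Definition der2Q : normal G :=
  Normal (dersQ_normal (nsetP derQ) (@dersQ_isolated G setT)).

Definition derp (p : nat) : normal G := Normal (@dersp_normal G p _ (nsetP wholeN)).
Definition der2p (p : nat) : normal G := Normal (@dersp_normal G p _ (nsetP (derp p))).

Definition secZ : absection G :=
  @AbSection G derZ der2Z (dersZ_sub (nsetP derZ)) (fun x => id).

Lemma sub_groot (S : set G) : S `<=` groot S.
Proof. by move=> x Sx; exists 1%N; rewrite ?expg1. Qed.

Definition secQ : absection G :=
  @AbSection G derQ der2Q
    (dersQ_sub (nsetP derQ) (@dersQ_isolated G setT)) (@sub_groot _).

Lemma gcommS_dersp p (H : set G) : gcommS H H `<=` dersp p H.
Proof. by move=> x Hx; apply: sub_gspan; right. Qed.

Definition secp (p : nat) : absection G :=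
  @AbSection G (derp p) (der2p p) (@dersp_sub G p _ (nsetP (derp p)))
    (@gcommS_dersp p _).

Lemma secp_exponent p (x : secmod (secp p)) : x *+ p = 0.
Proof.
apply: val_inj; rewrite /= secvalMn.
case: x => u /= /asboolP[g Hg <-]; rewrite -qprojX; apply/qproj_eq1.
by apply: sub_gspan; left; apply: sub_gspan; exists g.
Qed.

Definition Gab := quotg derZ.
Definition Gabf := quotg derQ.
Definition H1p (p : nat) := quotg (derp p).

Definition alexZ : lmodType (groupRing int Gab) :=
  grmod (zmodule_rep (sec_action secZ)).

Definition alexQ : zmodType := secmod secQ.
Definition alexQ_tensor : lmodType (groupRing rat Gabf) :=
  grmod (tensor_rep rat^o (sec_action secQ)).

Definition alexp (p : nat) (hp : prime p) : lmodType (groupRing 'F_p (H1p p)) :=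
  grmod (pmodule_rep hp (@secp_exponent p) (sec_action (secp p))).

(* The inclusions of the Alexander invariants in G/G'', G/G''_Q and G/G''_p. *)
Definition inclZ : alexZ -> quotg der2Z := @secval G secZ.
Definition inclQ : alexQ -> quotg der2Q := @secval G secQ.
Definition inclp (p : nat) (hp : prime p) : alexp hp -> quotg (der2p p) :=
  @secval G (secp p).

Lemma inclZ_act (g : G) (x : alexZ) :
  inclZ ((<< 1 *g qproj derZ g >> : groupRing int Gab) *: x)
    = (qproj der2Z g * inclZ x * (qproj der2Z g)^-1)%g.
Proof.
have -> : (<< 1 *g qproj derZ g >> : groupRing int Gab) *: x
          = sec_action secZ (qproj derZ g) x.
  by rewrite -[LHS]/(grscale _ _) grscaleU scale1r.
exact: (@secactE G secZ).
Qed.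

Lemma alexQ_act (g : G) (x : alexQ) (q : rat^o) (c : rat) :
  (<< c *g qproj derQ g >> : groupRing rat Gabf) *: (tens x q : alexQ_tensor)
    = tens (sec_action secQ (qproj derQ g) x : alexQ) (c * q : rat^o).
Proof.
rewrite -[LHS]/(grscale _ _) grscaleU -[X in c *: X]/(tensor_act _ _ _).
by rewrite tensor_actE scaler_tens.
Qed.

Lemma inclQ_act (g : G) (x : alexQ) :
  inclQ (sec_action secQ (qproj derQ g) x)
    = (qproj der2Q g * inclQ x * (qproj der2Q g)^-1)%g.
Proof. exact: (@secactE G secQ). Qed.

Lemma inclp_act (p : nat) (hp : prime p) (g : G) (x : alexp hp) :
  inclp ((<< 1 *g qproj (derp p) g >> : groupRing 'F_p (H1p p)) *: x)
    = (qproj (der2p p) g * inclp x * (qproj (der2p p) g)^-1)%g.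
Proof.
have -> : (<< 1 *g qproj (derp p) g >> : groupRing 'F_p (H1p p)) *: x
          = sec_action (secp p) (qproj (derp p) g) x.
  by rewrite -[LHS]/(grscale _ _) grscaleU scale1r.
exact: (@secactE G (secp p)).
Qed.

Lemma lcsQ_sub_alexQ n : lcsQ (quotg der2Q) n.+2 `<=` range inclQ.
Proof.
move=> u [m m0 Hu]; suff: in_secmod (s := secQ) u by move=> uP; exists (SecMod uP).
have {Hu} : (qproj der2Q @` gcommS setT setT) (u ^+ m)%g.
  move: {m m0 u} (u ^+ m)%g Hu.
  have [[C1 CM CV] _] := gcommS_normal (@setT_normal G) (@setT_normal G).
  apply: gspan_sub => [|_ [h _ [k _ ->]]].
    split=> [|_ _ [x Cx <-] [y Cy <-]|_ [x Cx <-]].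
    - by exists 1%g => //; exact: qproj1.
    - by exists (x * y)%g; [exact: CM|exact: qprojM].
    - by exists x^-1%g; [exact: CV|exact: qprojV].
  exists (gcomm (repr h) (repr k)).
    by apply: sub_gspan; exists (repr h) => //; exists (repr k).
  by rewrite /gcomm !qprojM !qprojV !qproj_repr.
case=> c Cc; rewrite -[u]qproj_repr; set g := repr u.
rewrite -qprojX => /esym/qprojP/(@sec_le _ secQ) gc.
apply/asboolP; exists g => //; apply: dersQ_isolated; exists m => //.
rewrite -[(g ^+ m)%g](mulgVK c).
have [[_ QM _] _] := nsetP derQ; apply: QM => //.
exact: sub_groot.
Qed.

End AlexanderInvariants.

(* Main.v *)
Require Import Defs.
From mathcomp Require Import all_boot all_order all_algebra.
From mathcomp Require Import boolp classical_sets.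
From mathcomp Require Import finmap monalg.

Set Implicit Arguments.
Unset Strict Implicit.
Unset Printing Implicit Defensive.

Import GRing.Theory.

Local Open Scope classical_set_scope.
Local Open Scope ring_scope.

(** In each of the three cases the module is a section N1/N2 of G, with N1 the
    first and N2 the second term of a derived series, and the action of G/N1
    on it is conjugation inside Q = G/N2. For a class g and an element x of
    the module, the commutator of g and x in Q is, additively,
    (g - 1) x. Since the elements g - 1 span the augmentation ideal I over the
    coefficients, the module I (I^n B) is the additive span of the differences
    (g - 1) x with x in I^n B ([idealS_idealXS]), and under the inclusion
    in Q this span is the commutator subgroup [Q, I^n B] ([gcommS_secval]). So
    multiplying by I and passing to the next term of the lower central series
    are the same operation, and all three claims follow by induction on n; for
    n = 0 one uses that the surjection from G to Q carries N1 onto the second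
    term of the series of Q.

    The variants add one remark each. Modulo p, the p-th powers adjoined at
    each step are trivial because the module has exponent p. Over the
    rationals, the isolator adjoined at each step is invisible after tensoring:
    if m x lies in S with m > 0, then x (x) q = m x (x) q / m
    ([tens_span_torsion]); and tensoring commutes with taking differences
    ([tens_span_gdiff]). *)

(** * Additive spans and products of ideals *)

Definition gdiff (Gam : groupType) (M : zmodType) (rho : gaction Gam M)
    (S : set M) : set M :=
  [set v | exists g, exists2 x, S x & v = rho g x - x].

Section AdditiveSpanTheory.
Variable V : zmodType.
Implicit Types (S W : set V).

Lemma zsubgroupB W x y : is_zsubgroup W -> W x -> W y -> W (x - y).
Proof. by case=> _ WD WN Wx Wy; apply: WD => //; apply: WN. Qed.

Lemma zsubgroup_sum W (I : Type) (r : seq I) (F : I -> V) :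
  is_zsubgroup W -> (forall i, W (F i)) -> W (\sum_(i <- r) F i).
Proof. by case=> W0 WD _ WF; elim/big_ind: _. Qed.

Lemma zsubgroup_preim (U : zmodType) (f : U -> V) W :
  {morph f : x y / x - y} -> is_zsubgroup W -> is_zsubgroup (f @^-1` W).
Proof.
move=> fB sW; have [W0 _ _] := sW.
have f0 : f 0 = 0 by rewrite -[0 in LHS](subrr 0) fB subrr.
have fN x : f (- x) = 0 - f x by rewrite -[- x]sub0r fB f0.
split=> [|x y Wx Wy|x Wx] /=; first by rewrite f0.
  rewrite -[y]opprK fB fN; apply: zsubgroupB => //; exact: zsubgroupB.
by rewrite fN; apply: zsubgroupB.
Qed.

Lemma zspan_morph (U : zmodType) (f : U -> V) (S : set U) W :
  {morph f : x y / x - y} -> is_zsubgroup W ->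
  (forall x, S x -> W (f x)) -> forall x, zspan S x -> W (f x).
Proof.
by move=> fB sW SW; apply: (zspan_sub (zsubgroup_preim fB sW)).
Qed.

End AdditiveSpanTheory.

Section IdealPowers.
Variables (A : nzRingType) (V : lmodType A).
Implicit Types (I J : set A) (W : set V).

Lemma idealS_idealM I J W : idealS (idealM I J) W = idealS I (idealS J W).
Proof.
apply/seteqP; split; apply: zspan_sub; try exact: zspan_zsubgroup.
- move=> _ [c Jc [w Ww ->]]; move: c Jc.
  apply: (zspan_morph (f := fun c => c *: w)).
    by move=> c d; exact: scalerBl.
    exact: zspan_zsubgroup.
  move=> _ [a Ia [b Jb ->]]; rewrite -scalerA; apply: sub_zspan.
  exists a => //; exists (b *: w) => //.
  by apply: sub_zspan; exists b => //; exists w.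
- move=> _ [a Ia [v Jv ->]]; move: v Jv.
  apply: (zspan_morph (f := fun v => a *: v)).
    by move=> u v; exact: scalerBr.
    exact: zspan_zsubgroup.
  move=> _ [b Jb [w Ww ->]]; rewrite scalerA; apply: sub_zspan.
  exists (a * b); last by exists w.
  by apply: sub_zspan; exists a => //; exists b.
Qed.

Lemma idealS_setT W : W `<=` idealS setT W.
Proof. by move=> v Wv; apply: sub_zspan; exists 1 => //; exists v; rewrite ?scale1r. Qed.

End IdealPowers.

(** * Powers of the augmentation ideal *)

Lemma gact_subB (Gam : groupType) (M : zmodType) (rho : gaction Gam M) g :
  {morph (fun x => rho g x - x) : x y / x - y}.
Proof.
move=> x y; have -> : rho g (x - y) = rho g x - rho g y.
  by apply: (addIr (rho g y)); rewrite -gactD !subrK.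
by rewrite !opprD addrACA.
Qed.

Section AugmentationPowers.
Variables (R : comNzRingType) (Gam : groupType) (V : lmodType R).
Variable rho : grep Gam V.
Local Notation I := (augIdeal R Gam).

Lemma augmentationE f : augmentation f = linext (fun _ : Gam => 1 : R^o) f.
Proof. by apply: eq_bigr => x _; rewrite /GRing.scale /= mulr1. Qed.

Lemma augIdealU x : I ((<< 1 *g x >> : groupRing R Gam) - 1).
Proof.
by rewrite /augIdeal /= augmentationE linearB /= !linextU subrr.
Qed.

(** If the coefficients of f sum to 0 then f w is the sum of the
    f_x (x w - w), hence of the x (f_x w) - f_x w; the stability hypothesis keeps
    f_x w in W, so that no coefficients are needed in the span. *)
Lemma idealS_augIdeal (W : set (grmod rho)) :
  (forall c v, W v -> W (c *: (v : V))) ->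
  idealS I W = zspan (gdiff rho W).
Proof.
move=> WZ; apply/seteqP; split; apply: zspan_sub; try exact: zspan_zsubgroup.
- move=> _ [f If [w Ww ->]].
  have -> : f *: w = \sum_(x <- msupp f) (rho x (f@_x *: (w : V)) - f@_x *: (w : V)).
    rewrite sumrB -scaler_suml -[\sum_(i <- _) f@_i]/(augmentation f) If scale0r subr0.
    by apply: eq_bigr => x _; rewrite grepZ.
  apply: (@zsubgroup_sum V (zspan (gdiff rho W))) => [|x]; first exact: zspan_zsubgroup.
  by apply: sub_zspan; exists x; exists (f@_x *: (w : V)) => //; apply: WZ.
- move=> _ [x [w Ww ->]]; apply: sub_zspan.
  exists ((<< 1 *g x >> : groupRing R Gam) - 1); first exact: augIdealU.
  exists w => //; rewrite scalerBl scale1r; congr (_ - _).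
  by rewrite -[RHS]/(grscale _ _) grscaleU scale1r.
Qed.

(** Coefficients commute with the group ring action; this provides the
    hypothesis of [idealS_augIdeal] when W is a power of I times the whole
    module. *)
Lemma idealS_scale (J : set (groupRing R Gam)) (W : set (grmod rho)) :
  (forall c v, W v -> W (c *: (v : V))) ->
  forall c v, idealS J W v -> idealS J W (c *: (v : V)).
Proof.
move=> WZ c; apply: (zspan_morph (f := fun v : V => c *: v)).
- by move=> u v; exact: scalerBr.
- exact: zspan_zsubgroup.
move=> _ [a Ja [w Ww ->]]; apply: sub_zspan; exists a => //.
exists (c *: (w : V)); first exact: WZ.
by rewrite -[in LHS]/(grscale a w) -grscaleZr.
Qed.

Lemma idealS_idealX0 : idealS (idealX I 0) [set: grmod rho] = setT.
Proof. by apply/seteqP; split=> // v _; exact: idealS_setT. Qed.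

Lemma idealS_idealXS n : idealS (idealX I n.+1) [set: grmod rho] =
  zspan (gdiff rho (idealS (idealX I n) [set: grmod rho])).
Proof.
rewrite -[idealX I n.+1]/(idealM I (idealX I n)) idealS_idealM.
by rewrite idealS_augIdeal //; apply: idealS_scale.
Qed.

End AugmentationPowers.

(** * Commutators in a quotient and differences in a section *)

Section SectionCommutators.
Variables (G : groupType) (s : absection G).
Local Notation N1 := (sec_top s).
Local Notation N2 := (sec_bot s).

Lemma secval_zspan (D : set (secmod s)) :
  @secval G s @` zspan D = gspan (@secval G s @` D).
Proof.
have [Z0 ZD ZN] := zspan_zsubgroup D; have [S1 SM SV] := gspan_subgroup (@secval G s @` D).
apply/seteqP; split.
- move=> _ [x Dx <-]; move: x Dx; apply: zspan_sub.
    by split=> [|x y|x]; [exact: S1|exact: SM|exact: SV].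
  by move=> x Dx; apply: sub_gspan; exists x.
- apply: gspan_sub; last by move=> _ [x Dx <-]; exists x => //; exact: sub_zspan.
  split; first by exists 0.
  + by move=> _ _ [x Zx <-] [y Zy <-]; exists (x + y) => //; exact: ZD.
  + by move=> _ [x Zx <-]; exists (- x) => //; exact: ZN.
Qed.

(** The dictionary between groups and modules: g x g^-1 x^-1 is the product of
    the conjugate of x with the inverse of x, that is (g - 1) x. *)
Lemma gcomm_secval g x : gcomm (qproj N2 g) (secval x) =
  secval (sec_action s (qproj N1 g) x - x).
Proof. by rewrite secvalD secvalN [secval (sec_action _ _ _)]secactE. Qed.

Lemma gcommS_secval (S : set (secmod s)) :
  gcommS setT (@secval G s @` S) = @secval G s @` zspan (gdiff (sec_action s) S).
Proof.
rewrite secval_zspan; congr gspan; apply/seteqP; split.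
- move=> _ [u _ [_ [x Sx <-] ->]]; rewrite -[u]qproj_repr gcomm_secval.
  by eexists; last by []; exists (qproj N1 (repr u)), x.
- move=> _ [_ [g [x Sx ->]] <-]; rewrite -[g]qproj_repr -gcomm_secval.
  by exists (qproj N2 (repr g)) => //; exists (secval x) => //; exists x.
Qed.

Lemma range_secval : range (@secval G s) = qproj N2 @` nset N1.
Proof.
apply/seteqP; split=> [_ [x _ <-]|u Nu]; first exact/asboolP/(secvalP x).
have uP : in_secmod (s := s) u by apply/asboolP.
by exists (SecMod uP).
Qed.

End SectionCommutators.

(** * Verbal constructions under a projection *)

Section ProjectionImages.
Local Open Scope group_scope.
Variables (G : groupType) (N : normal G).
Local Notation f := (qproj N).

Lemma qproj_gspan (S : set G) : f @` gspan S = gspan (f @` S).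
Proof.
have [S1 SM SV] := gspan_subgroup S.
have [T1 TM TV] := gspan_subgroup (f @` S).
apply/seteqP; split.
- move=> _ [x Sx <-]; move: x Sx; apply: gspan_sub.
    split=> [|x y Tx Ty|x Tx] /=; first by rewrite qproj1.
    + by rewrite qprojM; apply: TM.
    + by rewrite qprojV; apply: TV.
  by move=> x Sx; apply: sub_gspan; exists x.
- apply: gspan_sub; last by move=> _ [x Sx <-]; exists x => //; exact: sub_gspan.
  split; first by exists 1 => //; exact: qproj1.
  + by move=> _ _ [x Sx <-] [y Sy <-]; exists (x * y); [exact: SM|exact: qprojM].
  + by move=> _ [x Sx <-]; exists x^-1; [exact: SV|exact: qprojV].
Qed.

Lemma qproj_gcommS (H K : set G) : f @` gcommS H K = gcommS (f @` H) (f @` K).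
Proof.
have fR a b : f (gcomm a b) = gcomm (f a) (f b) by rewrite /gcomm !qprojM !qprojV.
rewrite qproj_gspan; congr gspan; apply/seteqP; split.
- move=> _ [_ [h Hh [k Kk ->]] <-].
  by exists (f h); [exists h|exists (f k); [exists k|]].
- move=> _ [_ [h Hh <-] [_ [k Kk <-] ->]]; rewrite -fR.
  by eexists; last by []; exists h => //; exists k.
Qed.

Lemma qproj_gpowS p (H : set G) : f @` gpowS p H = gpowS p (f @` H).
Proof.
rewrite qproj_gspan; congr gspan; apply/seteqP; split.
- by move=> _ [_ [h Hh ->] <-]; exists (f h); [exists h|rewrite qprojX].
- move=> _ [_ [h Hh <-] ->]; rewrite -qprojX.
  by eexists; last by []; exists h.
Qed.

Lemma qproj_setT : f @` setT = setT.
Proof. by apply/seteqP; split=> // u _; exists (repr u); rewrite ?qproj_repr. Qed.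

End ProjectionImages.

(** * Spans in tensor products *)

Section TensorSpan.
Variables (M N : zmodType).

Lemma tensBl (y : N) : {morph (fun x : M => tens x y) : x x' / x - x'}.
Proof. by move=> x x'; apply/eqP; rewrite eq_sym subr_eq -tensDl subrK. Qed.

Lemma tensMnl (x : M) (y : N) n : tens (x *+ n) y = tens x (y *+ n).
Proof.
elim: n => [|n IH]; last by rewrite !mulrS tensDl tensDr IH.
have e0 : tens (0 : M) y = 0 by have := tensBl y 0 0; rewrite !subrr.
by rewrite !mulr0n e0; apply: (addrI (tens x 0)); rewrite -tensDr !addr0.
Qed.

Lemma tens_span_setT : tens_span N [set: M] = setT.
Proof.
have [Z0 ZD ZN] := zspan_zsubgroup
  [set t : tensor M N | exists2 x, setT x & exists y, t = tens x y].
apply/seteqP; split=> // t _; move: t; apply: tensor_ind => // x y.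
by apply: sub_zspan; exists x => //; exists y.
Qed.

Lemma tens_spanS (S T : set M) : S `<=` T -> tens_span N S `<=` tens_span N T.
Proof.
move=> ST; apply: zspan_sub; first exact: zspan_zsubgroup.
by move=> _ [x Sx [y ->]]; apply: sub_zspan; exists x; [exact: ST|exists y].
Qed.

End TensorSpan.

(** Group elements act on the first factor only, so
    (g - 1) (x (x) y) = ((g - 1) x) (x) y on generators. *)
Lemma tens_span_gdiff (Gam : groupType) (R : comNzRingType) (M : zmodType)
    (N : lmodType R) (rho : gaction Gam M) (S : set M) :
  zspan (gdiff (tensor_rep N rho) (tens_span N S)) =
  tens_span N (zspan (gdiff rho S)).
Proof.
apply/seteqP; split; apply: zspan_sub; try exact: zspan_zsubgroup.
- move=> _ [g [t St ->]]; move: t St.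
  apply: (zspan_morph (f := fun t => tensor_rep N rho g t - t)).
  + exact: gact_subB.
  + exact: zspan_zsubgroup.
  move=> _ [x Sx [y ->]] /=; rewrite tensor_actE -tensBl; apply: sub_zspan.
  by exists (rho g x - x); [apply: sub_zspan; exists g, x|exists y].
- move=> _ [x Dx [y ->]]; move: x Dx.
  apply: (zspan_morph (tensBl y)); first exact: zspan_zsubgroup.
  move=> _ [g [x Sx ->]]; rewrite tensBl; apply: sub_zspan.
  exists g, (tens x y); first by apply: sub_zspan; exists x => //; exists y.
  by rewrite /= tensor_actE.
Qed.

(** Enlarging S inside its isolator changes nothing over the rationals: the
    multiplier m can be moved across the tensor sign and divided out. *)
Lemma tens_span_torsion (M : zmodType) (S T : set M) :
  S `<=` T -> (forall x, T x -> exists2 m, (0 < m)%N & S (x *+ m)) ->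
  tens_span rat^o S = tens_span rat^o T.
Proof.
move=> ST TS; apply/seteqP; split; first exact: tens_spanS.
apply: zspan_sub; first exact: zspan_zsubgroup.
move=> _ [x /TS[m m0 Sx] [q ->]]; apply: sub_zspan; exists (x *+ m) => //.
exists (q / m%:R : rat); rewrite tensMnl; congr tens.
by rewrite -[RHS]mulr_natr divfK // Num.Theory.pnatr_eq0 -lt0n.
Qed.

(** * The three lower central series *)

Section LowerCentralSeries.
Variable G : groupType.

Lemma idealX_alexZ n :
  @inclZ G @` idealS (idealX (augIdeal int (Gab G)) n) [set: alexZ G]
    = lcsZ (quotg (der2Z G)) n.+2.
Proof.
elim: n => [|n IH].
  rewrite idealS_idealX0 [LHS](range_secval (secZ G)).
  by rewrite [LHS]qproj_gcommS /= qproj_setT.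
rewrite idealS_idealXS -[RHS]/(gcommS setT (lcsZ _ n.+2)) -IH.
exact/esym/(gcommS_secval (s := secZ G)).
Qed.

Lemma inclQ_lcsQ0 : @inclQ G @^-1` lcsQ (quotg (der2Q G)) 2 = setT.
Proof.
apply/seteqP; split=> // x _ /=.
have : range (@inclQ G) (inclQ x) by exists x.
rewrite [range _](range_secval (secQ G)) => -[g [m m0 Hg] <-]; exists m => //.
by rewrite -qprojX -(qproj_setT (der2Q G)) -qproj_gcommS; exists (g ^+ m)%g.
Qed.

(** The isolator is taken in the whole quotient, but the rational lower central
    series stays inside the section, so it amounts to the condition that a
    positive multiple lies in the span of differences. *)
Lemma inclQ_lcsQS n (x : alexQ G) :
  lcsQ (quotg (der2Q G)) n.+3 (inclQ x) <->
  exists2 m, (0 < m)%N &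
    zspan (gdiff (sec_action (secQ G)) (@inclQ G @^-1` lcsQ (quotg (der2Q G)) n.+2))
      (x *+ m).
Proof.
set S := _ @^-1` _.
have HS : lcsQ (quotg (der2Q G)) n.+2 = @inclQ G @` S.
  apply/seteqP; split=> [u Hu|_ [y Sy <-] //].
  by have [y _ yu] := lcsQ_sub_alexQ Hu; exists y; rewrite /S /= ?yu.
have -> : lcsQ (quotg (der2Q G)) n.+3
    = groot (@inclQ G @` zspan (gdiff (sec_action (secQ G)) S)).
  rewrite -[LHS]/(groot (gcommS setT (lcsQ _ n.+2))) HS.
  by congr groot; exact: (gcommS_secval (s := secQ G)).
split=> -[m m0]; last by move=> Zx; exists m => //; exists (x *+ m); rewrite ?[LHS]secvalMn.
case=> y Zy; rewrite -[(inclQ x ^+ m)%g](secvalMn (s := secQ G)) => yx.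
exists m => //; have <- // : y = x *+ m by apply: val_inj.
Qed.

Lemma idealX_alexQ n :
  idealS (idealX (augIdeal rat (Gabf G)) n) [set: alexQ_tensor G]
    = tens_span (rat^o) (@inclQ G @^-1` lcsQ (quotg (der2Q G)) n.+2).
Proof.
elim: n => [|n IH]; first by rewrite idealS_idealX0 inclQ_lcsQ0 tens_span_setT.
rewrite idealS_idealXS IH [LHS]tens_span_gdiff; apply: tens_span_torsion => x.
  by move=> Zx; apply/inclQ_lcsQS; exists 1%N.
by move/inclQ_lcsQS.
Qed.

Lemma idealX_alexp n (p : nat) (hp : prime p) :
  @inclp G p hp @` idealS (idealX (augIdeal 'F_p (H1p G p)) n) [set: alexp G hp]
    = lcsp p (quotg (der2p G p)) n.+2.
Proof.
elim: n => [|n IH].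
  rewrite idealS_idealX0 [LHS](range_secval (secp G p)).
  rewrite [LHS]qproj_gspan image_setU qproj_gpowS qproj_gcommS /=.
  by rewrite qproj_setT.
rewrite idealS_idealXS.
rewrite -[RHS]/(gspan (gpowS p (lcsp p _ n.+2) `|` gcommS setT (lcsp p _ n.+2))).
rewrite -IH; set S := idealS _ _.
(* The p-th powers contribute nothing: the module has exponent p. *)
rewrite -[LHS](gcommS_secval (s := secp G p)).
have sC : is_subgroup (gcommS setT (@inclp G p hp @` S)) by exact: gspan_subgroup.
apply/seteqP; split; first by move=> u Cu; apply: sub_gspan; right.
apply: gspan_sub => // u [|//]; apply: gspan_sub => // _ [_ [x _ <-] ->].
rewrite -[(inclp x ^+ p)%g](secvalMn (s := secp G p)) secp_exponent.
by case: sC.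
Qed.

End LowerCentralSeries.

Theorem theorem1p1 (G : groupType) (n : nat) :
  [/\ @inclZ G @` idealS (idealX (augIdeal int (Gab G)) n) [set: alexZ G]
        = lcsZ (quotg (der2Z G)) n.+2,
      idealS (idealX (augIdeal rat (Gabf G)) n) [set: alexQ_tensor G]
        = tens_span (rat^o) (@inclQ G @^-1` lcsQ (quotg (der2Q G)) n.+2)
    & forall (p : nat) (hp : prime p),
        @inclp G p hp @`
            idealS (idealX (augIdeal 'F_p (H1p G p)) n) [set: alexp G hp]
        = lcsp p (quotg (der2p G p)) n.+2].
Proof.
split; [exact: idealX_alexZ|exact: idealX_alexQ|].
by move=> p hp; exact: idealX_alexp.
Qed.
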